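(* Let $K=\mathbb{R}$ or $K=\mathbb{C}$, let $(X,(\cdot,\cdot|\cdot))$ be a 2-inner product space over $K$, let $A,a\in K$ and $x,y,z\in X$. The following two conditions are equivalent: (i) $\mathrm{Re}\,(Ay-x,\;x-ay\,|\,z)\ge 0$; (ii) $\left\|x-\frac{a+A}{2}y\,\Big|\,z\right\|\le \frac12|A-a|\,\|y|z\|$. If (i) (equivalently, (ii)) holds, then $$0\le \|x|z\|^2\|y|z\|^2-|(x,y|z)|^2\le \frac14|A-a|^2\|y|z\|^4 .$$ The constant $\frac14$ is sharp in the sense that it cannot be replaced by a smaller constant: there is no constant $C<\frac14$ such that $\|x|z\|^2\|y|z\|^2-|(x,y|z)|^2\le C|A-a|^2\|y|z\|^4$ holds for all 2-inner product spaces $X$ over $K$ and all $x,y,z\in X$, $a,A\in K$ satisfying (i).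
   Context: Let $X$ be a linear space of dimension greater than $1$ over $K$, where $K=\mathbb{R}$ or $K=\mathbb{C}$. A 2-inner product on $X$ is a function $(\cdot,\cdot|\cdot):X\times X\times X\to K$ such that for all $x,x',y,z\in X$ and $\alpha\in K$: (1) $(x,x|z)\ge 0$, and $(x,x|z)=0$ if and only if $x$ and $z$ are linearly dependent; (2) $(x,x|z)=(z,z|x)$; (3) $(x,y|z)=\overline{(y,x|z)}$; (4) $(\alpha x,y|z)=\alpha(x,y|z)$; (5) $(x+x',y|z)=(x,y|z)+(x',y|z)$. The pair $(X,(\cdot,\cdot|\cdot))$ is then called a 2-inner product space over $K$. The associated 2-norm is $\|x|z\|=\sqrt{(x,x|z)}$ for $x,z\in X$. *)

(* Defs.v *)
From mathcomp Require Import all_boot all_order all_algebra.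
From mathcomp Require Import reals.
From mathcomp Require Import complex.

Set Implicit Arguments.
Unset Strict Implicit.
Unset Printing Implicit Defensive.

Import Order.TTheory GRing.Theory Num.Theory.
Local Open Scope ring_scope.

Variant scalar_kind := RealScalars | ComplexScalars.

Definition scalars (R : realType) (k : scalar_kind) : numFieldType :=
  match k with
  | RealScalars => R
  | ComplexScalars => R[i]
  end.

Definition conjK (R : realType) (k : scalar_kind) :
    scalars R k -> scalars R k :=
  match k return scalars R k -> scalars R k with
  | RealScalars => fun a : R => a
  | ComplexScalars => fun a : R[i] => conjc a
  end.

Definition reK (R : realType) (k : scalar_kind) : scalars R k -> R :=
  match k return scalars R k -> R with
  | RealScalars => fun a : R => a
  | ComplexScalars => fun a : R[i] => complex.Re a
  end.

(* The library modulus [`|a|] is a (real, nonnegative) element of the scalar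
   field itself; [absK a] is the same number as an element of [R]. *)
Definition absK (R : realType) (k : scalar_kind) (a : scalars R k) : R :=
  reK `|a|.

Definition lin_dep (K : fieldType) (X : lmodType K) (x z : X) : Prop :=
  exists a b : K, (a != 0 \/ b != 0) /\ a *: x + b *: z = 0.

(* In [tip_ge0] the order is that of the scalar field: over the complex
   numbers, [0 <= c] says that [c] is real and nonnegative. *)
Record two_ip_space (R : realType) (k : scalar_kind) := TwoIPSpace {
  tip_carrier :> lmodType (scalars R k);
  tip_dim_gt1 : exists u v : tip_carrier, ~ lin_dep u v;
  tip : tip_carrier -> tip_carrier -> tip_carrier -> scalars R k;
  tip_ge0 : forall x z, 0 <= tip x x z;
  tip_eq0 : forall x z, tip x x z = 0 <-> lin_dep x z;
  tip_swap : forall x z, tip x x z = tip z z x;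
  tip_conj : forall x y z, tip x y z = conjK (tip y x z);
  tip_scale : forall (a : scalars R k) x y z,
    tip (a *: x) y z = a * tip x y z;
  tip_add : forall x x' y z, tip (x + x') y z = tip x y z + tip x' y z
}.

Definition norm2 (R : realType) (k : scalar_kind) (X : two_ip_space R k)
    (x z : X) : R :=
  Num.sqrt (reK (tip x x z)).

(* Main.v *)
Require Import Defs.
From mathcomp Require Import all_boot all_order all_algebra.
From mathcomp Require Import reals.
From HB Require Import structures.
From mathcomp Require Import complex ring lra.
Import Order.TTheory GRing.Theory Num.Theory.
Local Open Scope ring_scope.

(** Fix [z] and put [m = (a + A) / 2], [d = (A - a) / 2].  For fixed [z] the
    2-inner product is a positive semidefinite Hermitian form in its first two
    arguments, and everything follows from two identities for such a form.

    - Polarization ([polarization]): since [A *: y - x = d *: y - (x - m *: y)]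
      and [x - a *: y = d *: y + (x - m *: y)], the real part of their product
      is [|d|^2 |y|z|^2 - |x - m y|z|^2].  Its nonnegativity is the second
      condition, squared.
    - Invariance of the Gram determinant of [x, y] under [x := x - m *: y]
      ([gram_shift]): the difference to be bounded equals
      [|x - m y|z|^2 |y|z|^2] minus a square, so it is at most
      [|d|^2 |y|z|^4] as soon as [|x - m y|z| <= |d| |y|z|].

    Its nonnegativity is the Cauchy-Schwarz inequality for a semidefinite form
    ([cauchy_schwarz]).

    Equality holds when [x - m *: y] is orthogonal to [y] and has norm
    [|d| |y|z|].  Modulo [z] this takes two independent directions, so the
    extremal example lives in dimension three: the coordinate vectors of [K^3]
    with [a = -1], [A = 1], for a 2-inner product made of 2 x 2 minors.

    The real and complex cases are treated together: identities between real
    numbers are transported along the embedding [ofR] of the reals into the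
    scalars, where squared norms become [tip x x z] and squared moduli become
    [a * conjK a], and are then checked by ring normalization. *)

(** * The scalar field and its real subfield *)

Section Scalars.
Variables (R : realType) (k : scalar_kind).
Local Notation K := (scalars R k).

Definition ofR : R -> K :=
  match k return R -> scalars R k with
  | RealScalars => fun r => r
  | ComplexScalars => fun r => real_complex R r
  end.

Lemma ofR_is_additive : additive ofR.
Proof. rewrite /ofR; case: k => // r s; exact: rmorphB. Qed.

Lemma ofR_is_multiplicative : multiplicative ofR.
Proof. by rewrite /ofR; case: k; split=> // r s; exact: rmorphM. Qed.

HB.instance Definition _ := GRing.isAdditive.Build R K ofR ofR_is_additive.
HB.instance Definition _ :=
  GRing.isMultiplicative.Build R K ofR ofR_is_multiplicative.

(** Unlike the generic [rmorphM], this leaves [ofR] itself as the head of both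
    factors, so that [ofR_absK_sqr] and [ofR_norm2_sqr] can still rewrite
    them. *)
Lemma ofRM r s : ofR (r * s) = ofR r * ofR s.
Proof. exact: rmorphM. Qed.

Lemma conjK_is_additive : additive (@conjK R k).
Proof. rewrite /conjK; case: k => // r s; exact: rmorphB. Qed.

Lemma conjK_is_multiplicative : multiplicative (@conjK R k).
Proof.
by rewrite /conjK; case: k; split=> // [r s|]; [exact: rmorphM | exact: rmorph1].
Qed.

HB.instance Definition _ :=
  GRing.isAdditive.Build K K (@conjK R k) conjK_is_additive.
HB.instance Definition _ :=
  GRing.isMultiplicative.Build K K (@conjK R k) conjK_is_multiplicative.

Lemma conjKK : involutive (@conjK R k).
Proof. by rewrite /conjK; case: k => // a; exact: conjcK. Qed.

Lemma conjK_ofR r : conjK (ofR r) = ofR r.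
Proof. by rewrite /conjK /ofR; case: k => //; exact: conjc_real. Qed.

Lemma reK_ofR : cancel ofR (@reK R k).
Proof. by rewrite /reK /ofR; case: k. Qed.

Lemma ofR_reK_ge0 (c : K) : 0 <= c -> ofR (reK c) = c.
Proof.
move: c; rewrite /reK /ofR; case: k => //= -[a b].
by rewrite lecE /= => /andP[/eqP-> _].
Qed.

Lemma reK_ge0 (c : K) : 0 <= c -> 0 <= reK c.
Proof.
by move: c; rewrite /reK; case: k => //= c; rewrite lecE => /andP[].
Qed.

Lemma ofR_reK (c : K) : 2 * ofR (reK c) = c + conjK c.
Proof.
move: c; rewrite /reK /ofR /conjK; case: k => [c|[a b]]; first by ring.
rewrite mulr_natl mulr2n; apply/eqP; rewrite eq_complex /=.
by rewrite subrr addr0 !eqxx.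
Qed.

Lemma normK_sqr (a : K) : `|a| ^+ 2 = a * conjK a.
Proof.
move: a; rewrite /conjK; case: k => a; last exact: sqr_normc.
by rewrite real_normK ?num_real // expr2.
Qed.

Lemma absK_ge0 (a : K) : 0 <= absK a.
Proof. exact/reK_ge0/normr_ge0. Qed.

Lemma ofR_absK_sqr (a : K) : ofR (absK a ^+ 2) = a * conjK a.
Proof. by rewrite rmorphXn /= /absK ofR_reK_ge0 // normK_sqr. Qed.

Lemma absKM (a b : K) : absK (a * b) = absK a * absK b.
Proof.
by apply: (can_inj reK_ofR); rewrite rmorphM /= /absK !ofR_reK_ge0 // normrM.
Qed.

Lemma absK_ofR r : 0 <= r -> absK (ofR r) = r.
Proof.
move=> r0; rewrite /absK ger0_norm ?reK_ofR //.
by move: r0; rewrite /ofR; case: k => //; rewrite lecE /= eqxx.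
Qed.

End Scalars.

(** * Identities in a 2-inner product space *)

Section TwoInnerProduct.
Variables (R : realType) (k : scalar_kind) (X : two_ip_space R k) (z : X).
Local Notation K := (scalars R k).
Implicit Types (x y : X) (a m d : K).

Lemma tipN x y : tip (- x) y z = - tip x y z.
Proof. by rewrite -scaleN1r tip_scale mulN1r. Qed.

Lemma tip_addr x y y' : tip x (y + y') z = tip x y z + tip x y' z.
Proof. by rewrite tip_conj tip_add rmorphD /= -!tip_conj. Qed.

Lemma tip_scaler a x y : tip x (a *: y) z = conjK a * tip x y z.
Proof. by rewrite tip_conj tip_scale rmorphM /= -tip_conj. Qed.

Lemma tipNr x y : tip x (- y) z = - tip x y z.
Proof. by rewrite tip_conj tipN rmorphN /= -tip_conj. Qed.

Definition tip_linE :=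
  (tip_add, tip_addr, tip_scale, tip_scaler, tipN, tipNr).

Lemma norm2_ge0 x : 0 <= norm2 x z.
Proof. exact: sqrtr_ge0. Qed.

Lemma ofR_norm2_sqr x : ofR R k (norm2 x z ^+ 2) = tip x x z.
Proof.
by rewrite /norm2 sqr_sqrtr ?ofR_reK_ge0 ?reK_ge0 // tip_ge0.
Qed.

(** The real part of the product of [u + v] and [u - v] is the difference of the
    squared norms, here for [u = d *: y] and [v = m *: y - x]. *)
Lemma polarization x y m d :
  reK (tip ((m + d) *: y - x) (x - (m - d) *: y) z) =
  (absK d * norm2 y z) ^+ 2 - norm2 (x - m *: y) z ^+ 2.
Proof.
apply: (can_inj (@reK_ofR R k)); have two0 : (2 : K) != 0 by rewrite pnatr_eq0.
apply: (mulfI two0); rewrite ofR_reK exprMn rmorphB rmorphM /=.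
rewrite !ofR_norm2_sqr ofR_absK_sqr !tip_linE.
rewrite !(rmorphD, rmorphB, rmorphN, rmorphM) /= -!tip_conj !conjKK.
ring.
Qed.

(** A Gram determinant does not change when a multiple of one vector is added
    to the other. *)
Lemma gram_shift x y m :
  norm2 x z ^+ 2 * norm2 y z ^+ 2 - absK (tip x y z) ^+ 2 =
  norm2 (x - m *: y) z ^+ 2 * norm2 y z ^+ 2
  - absK (tip (x - m *: y) y z) ^+ 2.
Proof.
apply: (can_inj (@reK_ofR R k)).
rewrite !rmorphB /= !(ofR_absK_sqr, ofR_norm2_sqr, ofRM).
rewrite !tip_linE.
rewrite !(rmorphD, rmorphB, rmorphN, rmorphM) /= -!tip_conj.
ring.
Qed.

(** For [t] the inverse of [norm2 y z ^+ 2] the vector is the component of [x]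
    orthogonal to [y]; leaving [t] free keeps the identity meaningful when [y]
    has norm zero. *)
Lemma norm2_sub_proj x y (t : R) :
  norm2 (x - (ofR R k t * tip x y z) *: y) z ^+ 2 =
  norm2 x z ^+ 2 - 2 * t * absK (tip x y z) ^+ 2
  + t ^+ 2 * absK (tip x y z) ^+ 2 * norm2 y z ^+ 2.
Proof.
apply: (can_inj (@reK_ofR R k)).
rewrite rmorphD rmorphB /=.
rewrite !(ofR_absK_sqr, ofR_norm2_sqr, ofRM).
rewrite !tip_linE !(rmorphD, rmorphB, rmorphN, rmorphM) /= conjK_ofR -!tip_conj.
ring.
Qed.

(** The quadratic polynomial in [t] given by [norm2_sub_proj] is nonnegative.
    Where [norm2 y z] vanishes it is affine in [t], hence constant, which forces
    [tip x y z] to vanish; otherwise its value at the minimizing [t] gives the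
    bound. *)
Lemma cauchy_schwarz x y :
  absK (tip x y z) ^+ 2 <= norm2 x z ^+ 2 * norm2 y z ^+ 2.
Proof.
set P := absK (tip x y z) ^+ 2.
have P0 : 0 <= P by exact: sqr_ge0.
have quad t : 0 <= norm2 x z ^+ 2 - 2 * t * P + t ^+ 2 * P * norm2 y z ^+ 2.
  by rewrite -norm2_sub_proj sqr_ge0.
have [y0|y0] := eqVneq (norm2 y z ^+ 2) 0.
- rewrite y0 mulr0 leNgt; apply/negP => Pgt0.
  (* the [t] at which the affine function takes the value [-1] *)
  have := quad ((norm2 x z ^+ 2 + 1) / (2 * P)).
  rewrite y0 mulr0 addr0.
  have -> : 2 * ((norm2 x z ^+ 2 + 1) / (2 * P)) * P = norm2 x z ^+ 2 + 1.
    by field; rewrite lt0r_neq0.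
  lra.
- have Y0 : 0 < norm2 y z ^+ 2 by rewrite lt0r y0 sqr_ge0.
  rewrite -ler_pdivrMr // -subr_ge0.
  rewrite (_ : _ - _ = norm2 x z ^+ 2 - 2 * (norm2 y z ^+ 2)^-1 * P
    + (norm2 y z ^+ 2)^-1 ^+ 2 * P * norm2 y z ^+ 2) ?quad //.
  field; move: y0; rewrite expf_eq0 //.
Qed.

End TwoInnerProduct.

(** * The standard 2-inner product on row vectors *)

Section Standard.
Variables (R : realType) (k : scalar_kind) (n : nat).
Local Notation K := (scalars R k).
Implicit Types x y z : 'rV[K]_n.

Definition minor2 x z (i j : 'I_n) : K := x 0 i * z 0 j - x 0 j * z 0 i.

(** The sum over all ordered pairs counts each minor twice, so this is twice the
    usual Gram determinant (see [std_tip_gram]).  Writing it with minors makes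
    positivity, the case of equality and the symmetry in [x] and [z]
    immediate. *)
Definition std_tip x y z : K :=
  \sum_i \sum_j minor2 x z i j * conjK (minor2 y z i j).

(** If the minors vanish and [x] has a nonzero coordinate [x 0 i], then
    [z 0 i *: x - x 0 i *: z = 0] is a nontrivial relation. *)
Lemma lin_dep_minor2 x z :
  lin_dep x z <-> forall i j, minor2 x z i j = 0.
Proof.
split=> [[a [b [ab0 /rowP eq0]]] i j|minor0].
- have ei := eq0 i; have ej := eq0 j; rewrite !mxE in ei ej.
  case: ab0 => c0; apply: (mulfI c0); rewrite mulr0 /minor2.
  + transitivity ((a * x 0 i + b * z 0 i) * z 0 j
                  - (a * x 0 j + b * z 0 j) * z 0 i); first by ring.
    by rewrite ei ej !mul0r subr0.
  + transitivity ((a * x 0 j + b * z 0 j) * x 0 i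
                  - (a * x 0 i + b * z 0 i) * x 0 j); first by ring.
    by rewrite ei ej !mul0r subr0.
- have [->|] := eqVneq x 0.
    exists 1, 0; split; first by left; rewrite oner_eq0.
    by rewrite scaler0 scale0r addr0.
  case/rV0Pn => i xi0; exists (z 0 i), (- x 0 i).
  split; first by right; rewrite oppr_eq0.
  apply/rowP => j; rewrite !mxE -[RHS](minor0 j i) /minor2; ring.
Qed.

Lemma std_tip_ge0 x z : 0 <= std_tip x x z.
Proof.
by do 2!(apply: sumr_ge0 => ? _); rewrite -normK_sqr exprn_ge0.
Qed.

Lemma std_tip_eq0 x z : std_tip x x z = 0 <-> lin_dep x z.
Proof.
have ge0 i j : 0 <= minor2 x z i j * conjK (minor2 x z i j).
  by rewrite -normK_sqr exprn_ge0.
rewrite lin_dep_minor2; split=> [/eqP|minor0]; last first.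
  by apply: big1 => i _; apply: big1 => j _; rewrite minor0 mul0r.
rewrite psumr_eq0 => [/allP sum0 i j|i _]; last exact: sumr_ge0.
have := sum0 i (mem_index_enum i); rewrite /= psumr_eq0 // => /allP sumi0.
have := sumi0 j (mem_index_enum j).
by rewrite /= -normK_sqr expf_eq0 normr_eq0 => /eqP.
Qed.

Lemma std_tip_swap x z : std_tip x x z = std_tip z z x.
Proof.
apply: eq_bigr => i _; apply: eq_bigr => j _.
have -> : minor2 x z i j = - minor2 z x i j by rewrite /minor2; ring.
by rewrite rmorphN mulrNN.
Qed.

Lemma std_tip_conj x y z : std_tip x y z = conjK (std_tip y x z).
Proof.
rewrite rmorph_sum; apply: eq_bigr => i _; rewrite rmorph_sum.
by apply: eq_bigr => j _; rewrite rmorphM /= conjKK mulrC.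
Qed.

Lemma std_tip_scale a x y z : std_tip (a *: x) y z = a * std_tip x y z.
Proof.
rewrite mulr_sumr; apply: eq_bigr => i _; rewrite mulr_sumr.
by apply: eq_bigr => j _; rewrite /minor2 !mxE; ring.
Qed.

Lemma std_tip_add x x' y z :
  std_tip (x + x') y z = std_tip x y z + std_tip x' y z.
Proof.
rewrite -big_split; apply: eq_bigr => i _; rewrite -big_split.
by apply: eq_bigr => j _; rewrite /minor2 !mxE /=; ring.
Qed.

Definition dot x y : K := \sum_i x 0 i * conjK (y 0 i).

Lemma dot_delta (p q : 'I_n) :
  dot (delta_mx 0 p) (delta_mx 0 q) = (p == q)%:R.
Proof.
rewrite /dot (bigD1 p) //= big1 ?addr0 => [|i /negPf ip].
  by rewrite !mxE !eqxx mul1r /= rmorph_nat.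
by rewrite !mxE ip andbF mul0r.
Qed.

(** The Lagrange (Binet-Cauchy) identity, obtained by multiplying out the
    products of minors: the four terms form two pairs exchanged by swapping
    the indices. *)
Lemma std_tip_gram x y z :
  std_tip x y z = 2 * (dot x y * dot z z - dot x z * dot z y).
Proof.
pose F i j := (x 0 i * conjK (y 0 i)) * (z 0 j * conjK (z 0 j))
  - (x 0 i * conjK (z 0 i)) * (z 0 j * conjK (y 0 j)).
have sumF : \sum_i \sum_j F i j = dot x y * dot z z - dot x z * dot z y.
  rewrite !big_distrlr -sumrB; apply: eq_bigr => i _.
  by rewrite -sumrB.
transitivity (\sum_i \sum_j (F i j + F j i)).
  apply: eq_bigr => i _; apply: eq_bigr => j _.
  by rewrite /F /minor2 rmorphB !rmorphM /=; ring.
under eq_bigr do rewrite big_split /=.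
by rewrite big_split /= [X in _ + X]exchange_big /= sumF mulr_natl mulr2n.
Qed.

Lemma std_tip_delta (p q r : 'I_n) : p != r ->
  std_tip (delta_mx 0 p) (delta_mx 0 q) (delta_mx 0 r) = 2 * (p == q)%:R.
Proof.
by move=> /negPf pr; rewrite std_tip_gram !dot_delta eqxx pr mulr1 mul0r subr0.
Qed.

End Standard.

Lemma rV_dim_gt1 (R : realType) (k : scalar_kind) (n : nat) :
  exists u v : 'rV[scalars R k]_n.+2, ~ lin_dep u v.
Proof.
exists (delta_mx 0 0), (delta_mx 0 1) => /lin_dep_minor2/(_ 0 1)/eqP.
by rewrite /minor2 !mxE /= mul0r mulr1 subr0 oner_eq0.
Qed.

Definition std_space (R : realType) (k : scalar_kind) (n : nat) :
    two_ip_space R k :=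
  @TwoIPSpace R k 'rV[scalars R k]_n.+2 (rV_dim_gt1 R k n)
    (@std_tip R k n.+2) (@std_tip_ge0 R k n.+2) (@std_tip_eq0 R k n.+2)
    (@std_tip_swap R k n.+2) (@std_tip_conj R k n.+2)
    (@std_tip_scale R k n.+2) (@std_tip_add R k n.+2).

Theorem theorem2p1 (R : realType) (k : scalar_kind) :
  (forall (X : two_ip_space R k) (A a : scalars R k) (x y z : X),
     (0 <= reK (tip (A *: y - x) (x - a *: y) z) <->
      norm2 (x - ((a + A) / 2) *: y) z <= 1 / 2 * absK (A - a) * norm2 y z)
     /\
     (0 <= reK (tip (A *: y - x) (x - a *: y) z) ->
      0 <= norm2 x z ^+ 2 * norm2 y z ^+ 2 - absK (tip x y z) ^+ 2
        <= 1 / 4 * absK (A - a) ^+ 2 * norm2 y z ^+ 4))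
  /\
  ~ (exists C : R, C < 1 / 4 /\
      forall (X : two_ip_space R k) (x y z : X) (a A : scalars R k),
        0 <= reK (tip (A *: y - x) (x - a *: y) z) ->
        norm2 x z ^+ 2 * norm2 y z ^+ 2 - absK (tip x y z) ^+ 2
          <= C * absK (A - a) ^+ 2 * norm2 y z ^+ 4).
Proof.
split=> [X A a x y z|[C [C_lt sharp]]].
- set m := (a + A) / 2; set h := absK ((A - a) / 2).
  have half : 1 / 2 * absK (A - a) = h.
    rewrite /h mulrC absKM; congr (_ * _).
    rewrite -[2 : scalars R k](rmorph_nat (ofR R k)) -fmorphV absK_ofR ?mul1r //.
    by rewrite invr_ge0 ler0n.
  have re_eq : reK (tip (A *: y - x) (x - a *: y) z) =
      (h * norm2 y z) ^+ 2 - norm2 (x - m *: y) z ^+ 2.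
    rewrite -polarization; congr (reK (tip (_ *: y - x) (x - _ *: y) z));
      by rewrite /m; field.
  have cond_iff : 0 <= reK (tip (A *: y - x) (x - a *: y) z) <->
      norm2 (x - m *: y) z <= h * norm2 y z.
    rewrite re_eq subr_ge0 ler_pXn2r // nnegrE ?norm2_ge0 //.
    by rewrite mulr_ge0 ?norm2_ge0 ?absK_ge0.
  split; first by rewrite half.
  rewrite re_eq subr_ge0 => cond.
  rewrite subr_ge0 cauchy_schwarz /= (gram_shift _ _ _ _ _ _ m).
  have -> : 1 / 4 * absK (A - a) ^+ 2 * norm2 y z ^+ 4 =
      (h * norm2 y z) ^+ 2 * norm2 y z ^+ 2 by rewrite -half; field.
  apply: le_trans (ler_wpM2r (sqr_ge0 _) cond).
  by rewrite gerBl sqr_ge0.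
(* [x] is orthogonal to [y] with the same norm, so with [a = -1], [A = 1] the
   condition holds with equality and the bound reads [4 <= 16 * C]. *)
- pose X := std_space R k 1.
  pose x : X := delta_mx 0 1; pose y : X := delta_mx 0 0.
  pose z : X := delta_mx 0 2.
  have tipxx : tip x x z = ofR R k 2.
    by rewrite [LHS]std_tip_delta // eqxx mulr1 rmorph_nat.
  have tipyy : tip y y z = ofR R k 2.
    by rewrite [LHS]std_tip_delta // eqxx mulr1 rmorph_nat.
  have tipxy : tip x y z = 0 by rewrite [LHS]std_tip_delta // mulr0.
  have tipyx : tip y x z = 0 by rewrite [LHS]std_tip_delta // mulr0.
  have normx : norm2 x z ^+ 2 = 2.
    by apply: (can_inj (@reK_ofR R k)); rewrite ofR_norm2_sqr.
  have normy : norm2 y z ^+ 2 = 2.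
    by apply: (can_inj (@reK_ofR R k)); rewrite ofR_norm2_sqr.
  have := sharp X x y z (-1) 1.
  rewrite tipxy.
  have -> : tip (1 *: y - x) (x - -1 *: y) z = 0.
    rewrite !tip_linE tipxy tipyx tipxx tipyy rmorphN rmorph1; ring.
  have -> : absK (1 - -1 : scalars R k) = 2.
    rewrite opprK -[1 + 1]/(2%:R) -(rmorph_nat (ofR R k)) absK_ofR //.
  rewrite -[4%N]/(2 * 2)%N exprM normx normy.
  have -> : absK (0 : scalars R k) = 0 by rewrite -(rmorph0 (ofR R k)) absK_ofR.
  have -> : reK (0 : scalars R k) = 0 by rewrite -(rmorph0 (ofR R k)) reK_ofR.
  move=> /(_ (lexx _)); lra.
Qed.
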